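(* Let $\mathbb{X},\mathbb{Y}$ be Euclidean spaces, $\Phi:\mathbb{X}\to\mathbb{Y}$ a linear operator, $y_0\in\mathbb{Y}$, and let $x_0$ be a minimizer of the problem $\min_{x\in\mathbb{X}} R(x)$ subject to $\Phi x=y_0$, where $R:\mathbb{X}\to\mathbb{R}$ is a convex function that is continuously twice differentiable around $x_0$. Then $$\operatorname{Ker}\Phi\cap T_{\partial R^*(\operatorname{Im}\Phi^* )}(x_0)\subset\operatorname{Ker}\Phi\cap\operatorname{Ker}\nabla^2R(x_0).$$ Consequently, stable recovery occurs at $x_0$ provided that $$\operatorname{Ker}\Phi\cap\operatorname{Ker}\nabla^2R(x_0)=\{0\},$$ and this last condition is equivalent to $x_0$ being a strong minimizer of the problem $\min_{x\in\mathbb{X}} R(x)$ subject to $\Phi x=y_0$.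
   Context: Euclidean spaces are finite-dimensional real inner product spaces; $\|\cdot\|$ is the associated norm. $\Phi^*$ is the adjoint of $\Phi$. $\nabla^2R(x_0)$ is the Hessian. Strong minimizer of the problem: $\Phi x_0=y_0$ and there are $\kappa,\varepsilon>0$ with $\varphi(x)-\varphi(x_0)\ge\frac{\kappa}{2}\|x-x_0\|^2$ for all $x$ with $\|x-x_0\|\le\varepsilon$, where $\varphi(x)=R(x)$ if $\Phi x=y_0$ and $\varphi(x)=\infty$ otherwise. Fenchel conjugate: $R^*(v)=\sup\{\langle v,x\rangle-R(x)\mid x\in\mathbb{X}\}$. $\partial$ is the convex subdifferential, so $x\in\partial R^*(v)$ if and only if $v\in\partial R(x)$. For a set $S$, $\partial R^*(S):=\bigcup_{v\in S}\partial R^*(v)$. Tangent (contingent) cone: for a closed set $\Omega\subset\mathbb{X}$ and $x_0\in\Omega$, $T_\Omega(x_0):=\{w\in\mathbb{X}\mid \exists\, t_k\downarrow 0,\ w_k\to w:\ x_0+t_kw_k\in\Omega\}$. Stable recovery: for $y\in\mathbb{Y}$ and $\mu>0$ let $P(y,\mu)$ be the problem $\min_{x\in\mathbb{X}}\frac12\|\Phi x-y\|^2+\mu R(x)$. Stable recovery occurs at $x_0$ if for every constant $c>0$ there exist $K>0$ and $\bar\delta>0$ such that for all $\delta\in(0,\bar\delta)$, all $y$ with $\|y-y_0\|\le\delta$, and $\mu=c\delta$, every optimal solution $x(y,\mu)$ of $P(y,\mu)$ satisfies $\|x(y,\mu)-x_0\|\le K\delta$. *)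

(* Defs.v *)
From HB Require Import structures.
From mathcomp Require Import all_boot all_order all_algebra.
From mathcomp Require Import all_classical all_reals all_analysis.
From mathcomp Require Import ring lra.

Set Implicit Arguments.
Unset Strict Implicit.
Unset Printing Implicit Defensive.

Import Order.TTheory GRing.Theory Num.Theory.
Import numFieldNormedType.Exports.

Local Open Scope classical_set_scope.
Local Open Scope ring_scope.

(* A Euclidean space is a finite-dimensional normed space whose norm comes from
   an inner product, so that the library's topology and differentials apply. *)
HB.mixin Record NormedVector_isEuclidean (K : realType) V
    of NormedModule K V & Vector K V := {
  dotp : {dot V for @idfun K} ;
  dotpxx : forall x : V, dotp x x = `|x| ^+ 2
}.

#[short(type="euclideanType")]
HB.structure Definition Euclidean (K : realType) :=
  {V of NormedModule K V & Vector K V & NormedVector_isEuclidean K V}.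

Section dot_norm.
Context (K : realType) (V : lmodType K) (form : {dot V for @idfun K}).

Definition dot_norm (x : V) : K := Num.sqrt (form x x).

Lemma dot_sym (x y : V) : form x y = form y x.
Proof. by rewrite (hermC form) expr0 mul1r. Qed.

Lemma dot_scaler a (x y : V) : form x (a *: y) = a * form x y.
Proof. by rewrite dot_sym linearZl dot_sym. Qed.

Lemma dot_ge0 (x : V) : 0 <= form x x.
Proof.
have [->|x0] := eqVneq x 0; first by rewrite linear0l.
exact/ltW/neq0_dnorm_gt0.
Qed.

Lemma dot_norm2 x : dot_norm x ^+ 2 = form x x.
Proof. exact/sqr_sqrtr/dot_ge0. Qed.

Lemma dot_norm_ge0 x : 0 <= dot_norm x.
Proof. exact: sqrtr_ge0. Qed.

Lemma dot_norm_eq0 x : dot_norm x = 0 -> x = 0.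
Proof.
move=> nx; apply/eqP/negPn/negP => /(neq0_dnorm_gt0 (s := form)).
by rewrite -dot_norm2 nx expr0n ltxx.
Qed.

Lemma dot_normZ a x : dot_norm (a *: x) = `|a| * dot_norm x.
Proof.
rewrite /dot_norm dot_scaler linearZl /= mulrA -expr2 sqrtrM ?sqr_ge0//.
by rewrite sqrtr_sqr.
Qed.

Lemma dot_le x y : form x y <= dot_norm x * dot_norm y.
Proof.
have [x0|x0] := eqVneq (dot_norm x) 0.
  by rewrite x0 mul0r (dot_norm_eq0 x0) linear0l.
have [y0|y0] := eqVneq (dot_norm y) 0.
  by rewrite y0 mulr0 (dot_norm_eq0 y0) dot_sym linear0l.
have xy0 : 0 < dot_norm x * dot_norm y.
  by rewrite mulr_gt0// lt0r ?x0 ?y0 dot_norm_ge0.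
have := dot_ge0 (dot_norm y *: x - dot_norm x *: y).
rewrite linearBl !linearBr !linearZl /= !dot_scaler.
rewrite (dot_sym y x) -!dot_norm2.
set a := dot_norm x; set b := dot_norm y; set c := form x y => h.
rewrite -subr_ge0 -(pmulr_rge0 _ (mulr_gt0 xy0 (ltr0n _ 2))).
apply: le_trans h _; rewrite le_eqVlt; apply/orP; left; apply/eqP.
by rewrite /a /b /c; ring.
Qed.

Lemma dot_ler_normD x y : dot_norm (x + y) <= dot_norm x + dot_norm y.
Proof.
rewrite -(@ler_pXn2r _ 2)// ?nnegrE ?addr_ge0 ?dot_norm_ge0//.
rewrite dot_norm2 linearDl !linearDr /= (dot_sym y x) sqrrD !dot_norm2.
have := dot_le x y; lra.
Qed.

End dot_norm.

(* Every finite-dimensional vector space with an inner product is Euclidean: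
   this factory derives the norm and the topology from the inner product. *)
HB.factory Record Vector_isEuclidean (K : realType) V of Vector K V := {
  inner : {dot V for @idfun K}
}.

HB.builders Context (K : realType) V of Vector_isEuclidean K V.

HB.instance Definition _ := @Lmodule_isNormed.Build K V (dot_norm inner)
  (dot_ler_normD inner) (dot_normZ inner) (@dot_norm_eq0 _ _ inner).

Let inner_norm (x : V) : inner x x = `|x| ^+ 2.
Proof. by rewrite -dot_norm2. Qed.

HB.instance Definition _ := NormedVector_isEuclidean.Build K V inner_norm.

HB.end.

Section euclidean.
Context {K : realType}.
Implicit Types X Y : euclideanType K.

Lemma dotpC X (x y : X) : dotp x y = dotp y x.
Proof. by rewrite (hermC dotp) expr0 mul1r. Qed.

Lemma dotp_inj X (x y : X) : (forall z, dotp z x = dotp z y) -> x = y.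
Proof.
move=> h; apply/eqP; rewrite -subr_eq0; apply/negPn/negP.
by move=> /(neq0_dnorm_gt0 (s := dotp)); rewrite linearBr /= h subrr ltxx.
Qed.

Lemma riesz X (l : {linear X -> K^o}) : exists g : X, forall x, l x = dotp g x.
Proof.
pose e := vbasis {:X}; pose n := \dim {:X}.
have be : basis_of {:X} e := vbasisP _.
have coordE (x : X) : x = \sum_(i < n) coord e i x *: e`_i.
  exact/coord_basis/memvf.
pose F (g : X) : 'rV[K]_n := \row_i dotp g e`_i.
have F_lin : linear F.
  by move=> a u v; apply/rowP => i; rewrite !mxE linearPl.
pose FL := GRing.isLinear.Build K X 'rV[K]_n *:%R F F_lin.
pose Fl : {linear X -> 'rV[K]_n} := HB.pack F FL.
pose f := linfun Fl.
have kf : lker f == 0%VS.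
  apply/lker0P => g1 g2; rewrite !lfunE /= => /rowP h.
  apply: dotp_inj => z; rewrite !(dotpC z) (coordE z) !linear_sumr.
  apply: eq_bigr => i _; have := h i; rewrite !mxE => hi.
  by rewrite !linearZr /= hi.
have lf : limg f = fullv.
  apply/eqP; rewrite eqEdim subvf /= limg_dim_eq; last first.
    by rewrite (eqP kf) capv0.
  by rewrite !dimvf /n dimvf dim_matrix mul1r.
have : (\row_i l e`_i : 'rV[K]_n) \in limg f by rewrite lf memvf.
move=> /memv_imgP[g _]; rewrite lfunE /= => /rowP h.
exists g => x; rewrite (coordE x) linear_sum linear_sumr.
apply: eq_bigr => i _; have := h i; rewrite !mxE => hi.
by rewrite linearZ linearZr /= hi.
Qed.

Definition adjoint X Y (Phi : {linear X -> Y}) : {linear Y -> X} :=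
  get [set Psi : {linear Y -> X} |
    forall x y, dotp (Phi x) y = dotp x (Psi y)].

Lemma adjointP X Y (Phi : {linear X -> Y}) x y :
  dotp (Phi x) y = dotp x (adjoint Phi y).
Proof.
suff [Psi hPsi] : exists Psi : {linear Y -> X},
    forall x y, dotp (Phi x) y = dotp x (Psi y).
  exact: (getPex (P := [set Psi : {linear Y -> X} |
    forall x y, dotp (Phi x) y = dotp x (Psi y)]) (ex_intro _ _ hPsi)).
have /choice[psi hpsi] : forall y : Y, exists g : X,
    forall x, dotp (Phi x) y = dotp x g.
  move=> z; pose l (x : X) : K^o := dotp (Phi x) z.
  have l_lin : linear l by move=> a u v; rewrite /l linearP linearPl.
  pose L := GRing.isLinear.Build K X K^o *:%R l l_lin.
  have [g hg] := riesz (HB.pack l L : {linear X -> K^o}).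
  by exists g => u; rewrite [RHS]dotpC; exact: hg.
have psi_lin : linear psi.
  move=> a u v; apply: dotp_inj => z.
  by rewrite -hpsi !linearPr /= !hpsi.
pose L := GRing.isLinear.Build K Y X *:%R psi psi_lin.
by exists (HB.pack psi L : {linear Y -> X}).
Qed.

(* Meaningful when f is differentiable at x. *)
Definition grad X (f : X -> K) (x : X) : X :=
  get [set g : X | forall v, 'd (f : X -> K^o) x v = dotp g v].

Lemma gradP X (f : X -> K) (x v : X) :
  'd (f : X -> K^o) x v = dotp (grad f x) v.
Proof.
have [g hg] := riesz ('d (f : X -> K^o) x : {linear X -> K^o}).
exact: (getPex (P := [set g : X | forall v, 'd (f : X -> K^o) x v = dotp g v])
  (ex_intro _ _ hg)).
Qed.

Definition hessian X (f : X -> K) (x : X) : {linear X -> X} :=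
  'd (grad f) x.

(* The continuity of the Hessian is with respect to the operator norm. *)
Definition C2_around X (f : X -> K) (x0 : X) : Prop :=
  \forall x \near x0,
    [/\ differentiable (f : X -> K^o) x,
        differentiable (grad f) x &
        forall e : K, 0 < e ->
          \forall z \near x, forall v,
            `|hessian f z v - hessian f x v| <= e * `|v| ].

Definition Ker X Y (A : {linear X -> Y}) : set X := [set x | A x = 0].

Definition conjugate X (f : X -> K) (v : X) : \bar K :=
  ereal_sup [set (dotp v x - f x)%:E | x in [set: X]].

(* The subdifferential is empty where the function is infinite. *)
Definition subdiff X (F : X -> \bar K) (v : X) : set X :=
  [set x | F v \is a fin_num /\
           forall u, (F v + (dotp x (u - v))%:E <= F u)%E].

Definition subdiff_image X (F : X -> \bar K) (S : set X) : set X :=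
  \bigcup_(v in S) subdiff F v.

Definition tangent_cone X (Omega : set X) (x0 : X) : set X :=
  [set w | exists (t_ : nat -> K) (w_ : nat -> X),
    [/\ forall k, 0 < t_ k, t_ @ \oo --> (0 : K), w_ @ \oo --> w &
        forall k, Omega (x0 + t_ k *: w_ k)]].

Definition minimizer X Y (R : X -> K) (Phi : {linear X -> Y}) (y0 : Y)
    (x0 : X) : Prop :=
  Phi x0 = y0 /\ forall x, Phi x = y0 -> R x0 <= R x.

Definition restricted X Y (R : X -> K) (Phi : {linear X -> Y}) (y0 : Y)
    (x : X) : \bar K :=
  if Phi x == y0 then (R x)%:E else +oo%E.

Definition strong_minimizer X Y (R : X -> K) (Phi : {linear X -> Y}) (y0 : Y)
    (x0 : X) : Prop :=
  Phi x0 = y0 /\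
  exists kappa eps : K, [/\ 0 < kappa, 0 < eps &
    forall x, `|x - x0| <= eps ->
      ((kappa / 2 * `|x - x0| ^+ 2)%:E <=
        restricted R Phi y0 x - restricted R Phi y0 x0)%E].

Definition regularized X Y (R : X -> K) (Phi : {linear X -> Y}) (y : Y)
    (mu : K) (x : X) : K :=
  2^-1 * `|Phi x - y| ^+ 2 + mu * R x.

Definition regularized_solution X Y (R : X -> K) (Phi : {linear X -> Y})
    (y : Y) (mu : K) (x : X) : Prop :=
  forall x', regularized R Phi y mu x <= regularized R Phi y mu x'.

Definition stable_recovery X Y (R : X -> K) (Phi : {linear X -> Y}) (y0 : Y)
    (x0 : X) : Prop :=
  forall c : K, 0 < c ->
  exists C delta_bar : K, [/\ 0 < C, 0 < delta_bar &
    forall delta : K, 0 < delta -> delta < delta_bar ->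
    forall y : Y, `|y - y0| <= delta ->
    forall x : X, regularized_solution R Phi y (c * delta) x ->
      `|x - x0| <= C * delta].

End euclidean.

(* Main.v *)
Require Import Defs.
From mathcomp Require Import all_boot all_order all_algebra.
From mathcomp Require Import all_classical all_reals all_analysis.
From mathcomp Require Import ring lra.

(** Write [g] for the gradient of [R] and [H] for its Hessian at [x0].

    Second-order information enters only through the inequality
    [dotp (H w) (z - w) <= dotp (H z) z], obtained by adding the three
    gradient inequalities of the convex function [R] around the triangle [x0],
    [x0 + t w], [x0 + t z] and letting [t] tend to 0
    ([hessian_three_point]).  It makes [H] cocoercive,
    [m |H w|^2 <= dotp (H w) w] ([three_point_cocoercive]); hence a vector on
    which the quadratic form of [H] vanishes lies in [Ker H].  This replaces
    the symmetry of the Hessian, so neither mixed derivatives nor a Taylor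
    formula of order two come in.

    The points of [subdiff_image (conjugate R) (range (adjoint Phi))] near
    [x0] and the solutions of the regularized problems share one property:
    they minimize [R] on their own translate of [Ker Phi]
    ([min_along_ker]).  Where [R] is differentiable, this makes [g x]
    orthogonal to [Ker Phi].  As [x0] has the same property, so does
    [g x - g x0], which is [H (x - x0)] up to a small error.

    - Inclusion of the cones.  Along a tangent direction [w] in [Ker Phi] the
      orthogonality passes to the limit and gives [dotp (H w) w = 0], so
      [H w = 0].

    - If the two kernels meet only at 0, then [H + Phi^* Phi] is definite and
      satisfies the three-point inequality, so
      [m |h|^2 <= dotp (H h) h + |Phi h|^2] for some [m > 0]
      ([hessian_coercive]); cocoercivity together with a bounded inverse
      stands in for compactness of the sphere.  Gradient inequalities turn
      this into quadratic growth of the Bregman distance of [R] at [x0], up to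
      a multiple of [|Phi h|^2] ([bregman_growth]), and strong minimality is
      the case [Phi h = 0].

    - Stable recovery.  Comparing the energies of the solution [x = x0 + h]
      and of [x0] bounds [|Phi h|] and the Bregman distance of [x] by
      multiples of the noise level [d].  The growth bound and convexity then
      confine [h] to a small ball, but alone they would only give [|h|] of
      order [sqrt d].  The linear rate comes from orthogonality:
      [g x - g x0] has size [O(|h|)], so
      [dotp (g x - g x0) h <= C |h| |Phi h|]
      ([ker_orthogonal_bound]), whereas the left-hand side controls
      [dotp (H h) h], hence [|h|^2].

    - A strong minimizer leaves no room for a common kernel vector [w]:
      along it [R (x0 + t w) - R x0] is [o(t^2)]. *)

Set Implicit Arguments.
Unset Strict Implicit.
Unset Printing Implicit Defensive.

Import Order.TTheory GRing.Theory Num.Theory.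
Import numFieldNormedType.Exports.

Local Open Scope classical_set_scope.
Local Open Scope ring_scope.

(** * Inner products and linear maps *)

Lemma dotp_le_norm (K : realType) (X : euclideanType K) (x y : X) :
  dotp x y <= `|x| * `|y|.
Proof.
have nE (z : X) : dot_norm dotp z = `|z|.
  by rewrite /dot_norm dotpxx sqrtr_sqr normr_id.
by rewrite -!nE dot_le.
Qed.

Lemma dotp_norm_le (K : realType) (X : euclideanType K) (x y : X) :
  `|dotp x y| <= `|x| * `|y|.
Proof.
rewrite ler_norml dotp_le_norm andbT lerNl -linearNl -[`|x|]normrN.
exact: dotp_le_norm.
Qed.

Section dotp_rules.
Context (K : realType) (X : euclideanType K).
Implicit Types x y z : X.

Lemma dotpDl x y z : dotp (x + y) z = dotp x z + dotp y z.
Proof. exact: linearDl. Qed.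
Lemma dotpDr x y z : dotp z (x + y) = dotp z x + dotp z y.
Proof. exact: linearD. Qed.
Lemma dotpBl x y z : dotp (x - y) z = dotp x z - dotp y z.
Proof. exact: linearBl. Qed.
Lemma dotpBr x y z : dotp z (x - y) = dotp z x - dotp z y.
Proof. exact: linearB. Qed.
Lemma dotpZl a x y : dotp (a *: x) y = a * dotp x y.
Proof. exact: linearZl. Qed.
Lemma dotpZr a x y : dotp x (a *: y) = a * dotp x y.
Proof. exact: linearZr. Qed.
Lemma dotpNr x y : dotp x (- y) = - dotp x y.
Proof. exact: linearN. Qed.
End dotp_rules.

(** The coordinates of a vector in a basis are inner products with fixed
    vectors, so the Cauchy-Schwarz inequality bounds each of them. *)
Lemma linear_bounded (K : realType) (X : euclideanType K)
    (V : normedModType K) (A : {linear X -> V}) :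
  exists2 M : K, 0 < M & forall x, `|A x| <= M * `|x|.
Proof.
pose e := vbasis {:X}; pose n := \dim {:X}.
have coordE (x : X) : x = \sum_(i < n) coord e i x *: e`_i.
  exact/coord_basis/memvf/vbasisP.
have /choice[g gE] : forall i : 'I_n, exists g : X,
    forall x, coord e i x = dotp g x.
  by move=> i; exact: (riesz (coord e i : {linear X -> K^o})).
have S0 : 0 <= \sum_(i < n) `|g i| * `|A e`_i|.
  by apply: sumr_ge0 => i _; rewrite mulr_ge0.
exists (1 + \sum_(i < n) `|g i| * `|A e`_i|); first by rewrite ltr_pwDl.
move=> x; rewrite mulrDl mul1r.
apply: le_trans (_ : (\sum_(i < n) `|g i| * `|A e`_i|) * `|x| <= _); last first.
  by rewrite lerDr.
rewrite {1}(coordE x) linear_sum mulr_suml.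
apply: le_trans (ler_norm_sum _ _ _) _; apply: ler_sum => i _.
rewrite linearZ normrZ /= gE mulrAC ler_wpM2r//.
exact: dotp_norm_le.
Qed.

Section linear_forms.
Context (K : realType) (X Y : euclideanType K).

(** Testing the inequality with [z] a small multiple of [A w] leaves a gain
    of first order in the multiple against a loss of second order. *)
Lemma three_point_cocoercive (A : {linear X -> X}) :
  (forall w z, dotp (A w) (z - w) <= dotp (A z) z) ->
  exists2 m : K, 0 < m & forall w, m * `|A w| ^+ 2 <= dotp (A w) w.
Proof.
move=> A3; have [M M0 hM] := linear_bounded A.
(* s |A w|^2 - s^2 M |A w|^2 is largest at s = 1 / (2 M). *)
exists (4 * M)^-1; first by rewrite invr_gt0 mulr_gt0.
move=> w; set s := (2 * M)^-1.
have sM : s * M = 2^-1 by rewrite /s invfM mulfVK// gt_eqF.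
have s0 : 0 < s by rewrite invr_gt0 mulr_gt0.
have -> : (4 * M)^-1 = s / 2.
  by rewrite /s -invfM; congr (_^-1); ring.
have := A3 w (s *: A w); rewrite dotpBr [A (s *: _)]linearZ.
rewrite dotpZl !dotpZr dotpxx => h.
have h1 : s * dotp (A (A w)) (A w) <= s * (M * `|A w| ^+ 2).
  rewrite (ler_pM2l s0) expr2 mulrA.
  by apply: le_trans (dotp_le_norm _ _) _; rewrite ler_wpM2r.
rewrite mulrA sM in h1.
have := ler_wpM2l (ltW s0) h1; lra.
Qed.

(** Definiteness makes [A] injective, hence boundedly invertible, so [|A w|]
    in the cocoercivity bound dominates a multiple of [|w|]. *)
Lemma three_point_coercive (A : {linear X -> X}) :
  (forall w z, dotp (A w) (z - w) <= dotp (A z) z) ->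
  (forall w, dotp (A w) w = 0 -> w = 0) ->
  exists2 m : K, 0 < m & forall w, m * `|w| ^+ 2 <= dotp (A w) w.
Proof.
move=> A3 A_def; have [m m0 hm] := three_point_cocoercive A3.
have kA : lker (linfun A) == 0%VS.
  apply/lker0P => u v; rewrite !lfunE /= => uv.
  apply/eqP; rewrite -subr_eq0; apply/eqP/A_def.
  by rewrite [A _]linearB uv subrr linear0l.
have [N N0 hN] := linear_bounded ((linfun A)^-1%VF : {linear X -> X}).
have AN w : `|w| <= N * `|A w|.
  have AK := lker0_lfunK kA w; rewrite lfunE /= in AK.
  by have := hN (A w); rewrite /= AK.
exists (m / N ^+ 2); first by rewrite divr_gt0// exprn_gt0.
move=> w; apply: le_trans (hm w); rewrite -mulrA ler_pM2l//.
rewrite mulrC ler_pdivrMr ?exprn_gt0// mulrC -exprMn.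
by rewrite ler_pXn2r ?nnegrE// mulr_ge0// ltW.
Qed.

(** A vector orthogonal to [Ker Phi] lies in the range of the adjoint, so its
    product with [h] only sees [Phi h].  With [Psi] a generalized inverse of
    [Phi], the difference [h - Psi (Phi h)] is in [Ker Phi], which gives the
    bound without naming a preimage under the adjoint. *)
Lemma ker_orthogonal_bound (Phi : {linear X -> Y}) :
  exists2 M : K, 0 < M & forall v, (forall w, Phi w = 0 -> dotp v w = 0) ->
    forall h, `|dotp v h| <= M * `|v| * `|Phi h|.
Proof.
pose Psi := ((linfun Phi)^-1)%VF.
have [M M0 hM] := linear_bounded (Psi : {linear Y -> X}).
exists M => // v vK h.
have -> : dotp v h = dotp v (Psi (Phi h)).
  apply/eqP; rewrite -subr_eq0 -dotpBr; apply/eqP/vK.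
  have PhiK : linfun Phi (Psi (linfun Phi h)) = linfun Phi h.
    by rewrite limg_lfunVK// memv_img// memvf.
  by move: PhiK; rewrite !lfunE linearB /= => ->; rewrite subrr.
apply: le_trans (dotp_norm_le _ _) _.
rewrite (mulrC M) -mulrA; apply: ler_wpM2l => //; exact: hM.
Qed.

End linear_forms.

(** * Gradients of convex functions *)

Lemma differentiable_approx (K : realType) (V W : normedModType K)
    (f : V -> W) (x : V) : differentiable f x ->
  forall e : K, 0 < e ->
  exists2 r : K, 0 < r & forall h, `|h| < r ->
    `|f (x + h) - f x - 'd f x h| <= e * `|h|.
Proof.
move=> /diff_locally/eqaddoP df e e0.
have /nbhs_ballP[r /= r0 hr] := df _ e0; exists r => // h hlt.
have := hr h; rewrite -ball_normE /= sub0r normrN => /(_ hlt).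
by rewrite /cst !fctE /shift /= (addrC h x) opprD addrA.
Qed.

Lemma le0_eps_mul (K : realType) (a b : K) :
  0 <= b -> (forall e, 0 < e -> a <= e * b) -> a <= 0.
Proof.
move=> b0 h; apply/ler_addgt0Pr => e e0; rewrite add0r.
have b1 : 0 < b + 1 by rewrite ltr_wpDl.
apply: le_trans (h _ (divr_gt0 e0 b1)) _.
rewrite -mulrA ger_pMr// mulrC ler_pdivrMr//; lra.
Qed.

Lemma small_step (K : realType) (V : normedModType K) (r : K) (d d' : V) :
  0 < r ->
  exists t : K, [/\ 0 < t, t <= 1, `|t *: d| < r & `|t *: d'| < r].
Proof.
move=> r0; pose b := `|d| + `|d'| + r + 1.
have [dn dn'] := (normr_ge0 d, normr_ge0 d').
have b0 : 0 < b by rewrite /b; lra.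
exists (r / b); have t0 : 0 < r / b by rewrite divr_gt0.
have tb : r / b * b = r by rewrite divfK// gt_eqF.
split => //; first by rewrite ler_pdivrMr// mul1r /b; lra.
- by rewrite normrZ gtr0_norm// -[ltRHS]tb ltr_pM2l// /b; lra.
- by rewrite normrZ gtr0_norm// -[ltRHS]tb ltr_pM2l// /b; lra.
Qed.

Lemma convex_along (K : realType) (X : lmodType K) (f : X -> K) (x d : X)
    (t : K) : convex_function [set: X] (f : X -> K^o) ->
  0 <= t -> t <= 1 -> f (x + t *: d) <= f x + t * (f (x + d) - f x).
Proof.
move=> fc t0 t1.
have := fc (Itv01 t0 t1) (x + d) x; rewrite !in_setE => /(_ Logic.I Logic.I).
have -> : conv (Itv01 t0 t1) (x + d : convex_lmodType X) x = x + t *: d.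
  rewrite -[LHS]/(t *: (x + d) + (1 - t) *: x) scalerDr scalerBl scale1r.
  by rewrite addrC addrA subrK.
move=> /le_trans; apply; rewrite -[leLHS]/(t * f (x + d) + (1 - t) * f x).
by rewrite le_eqVlt; apply/orP; left; apply/eqP; ring.
Qed.

Lemma convex_differentiable_grad (K : realType) (X : euclideanType K)
    (f : X -> K) (x : X) :
  convex_function [set: X] (f : X -> K^o) -> differentiable (f : X -> K^o) x ->
  forall z, dotp (grad f x) (z - x) <= f z - f x.
Proof.
move=> fc fd z; rewrite -subr_le0; set d := z - x.
apply: (@le0_eps_mul _ _ `|d|) => // e e0.
have [r r0 hr] := differentiable_approx fd e0.
have [t [t0 t1 tdr _]] := small_step d d r0.
have := hr _ tdr; rewrite gradP linearZr /= normrZ gtr0_norm// => /ler_normlP[].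
have := convex_along x d fc (ltW t0) t1.
have -> : x + d = z by rewrite /d addrC subrK.
move=> cvx app _.
rewrite -(ler_pM2l t0); lra.
Qed.

(** * The Hessian of a convex function *)

Lemma add_remainder (V : zmodType) (a b c : V) : a = b + (c + (a - b - c)).
Proof. by rewrite [c + _]addrC subrK addrC subrK. Qed.

Section second_order.
Context (K : realType) (X : euclideanType K) (R : X -> K) (x0 : X).
Context (R_convex : convex_function [set: X] (R : X -> K^o)).
Context (R_C2 : C2_around R x0).
Let g := grad R.
Let H := hessian R x0.

Lemma C2_local (e : K) : 0 < e ->
  exists2 r : K, 0 < r & forall h, `|h| < r ->
    differentiable (R : X -> K^o) (x0 + h) /\
    `|g (x0 + h) - g x0 - H h| <= e * `|h|.
Proof.
move=> e0; have [_ dg _] := nbhs_singleton R_C2.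
have [r r0 hr] := differentiable_approx dg e0.
have /nbhs_ballP[s /= s0 hs] := R_C2.
exists (Num.min r s); first by rewrite lt_min r0.
move=> h; rewrite lt_min => /andP[hr' hs']; split; last exact: hr.
have [] := hs (x0 + h) => //.
by rewrite -ball_normE /ball_ /= opprD addrA subrr add0r normrN.
Qed.

(** Cyclic monotonicity of the gradient along the triangle [x0], [x0 + t w],
    [x0 + t z], divided by [t^2]: the values of [R] and the terms in [g x0]
    cancel. *)
Lemma hessian_three_point w z : dotp (H w) (z - w) <= dotp (H z) z.
Proof.
rewrite -subr_le0; set b := `|w| * `|z - w| + `|z| * `|z|.
apply: (@le0_eps_mul _ _ b).
  by rewrite addr_ge0// mulr_ge0.
move=> e e0; have [r r0 hr] := C2_local e0.
have [t [t0 _ twr tzr]] := small_step w z r0.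
have [Dw gw] := hr _ twr; have [Dz gz] := hr _ tzr.
have [|D0 _] := hr 0; first by rewrite normr0.
rewrite addr0 in D0.
have c1 := convex_differentiable_grad R_convex D0 (x0 + t *: w).
have c2 := convex_differentiable_grad R_convex Dw (x0 + t *: z).
have c3 := convex_differentiable_grad R_convex Dz x0.
have tn : `|t| = t by rewrite gtr0_norm.
set aw := g (x0 + t *: w) - g x0 - H (t *: w) in gw.
set az := g (x0 + t *: z) - g x0 - H (t *: z) in gz.
have gwE : g (x0 + t *: w) = g x0 + (t *: H w + aw).
  by rewrite -linearZ -add_remainder.
have gzE : g (x0 + t *: z) = g x0 + (t *: H z + az).
  by rewrite -linearZ -add_remainder.
move: c1 c2 c3; rewrite -/g gwE gzE.
have -> : x0 + t *: w - x0 = t *: w by rewrite addrC addKr.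
have -> : x0 - (x0 + t *: z) = - (t *: z) by rewrite opprD addrA subrr add0r.
have -> : x0 + t *: z - (x0 + t *: w) = t *: (z - w).
  by rewrite opprD addrACA subrr add0r scalerBr.
have := dotp_norm_le aw (z - w) ; have := dotp_norm_le az z.
rewrite !ler_norml => /andP[_ hz] /andP[hw _] c1 c2 c3.
rewrite !normrZ tn in gw gz.
clearbody aw az.
have pw : t * (`|aw| * `|z - w|) <= t * (e * (t * `|w|) * `|z - w|).
  by rewrite (ler_pM2l t0) ler_wpM2r.
have pz : t * (`|az| * `|z|) <= t * (e * (t * `|z|) * `|z|).
  by rewrite (ler_pM2l t0) ler_wpM2r.
have qw : - (t * (`|aw| * `|z - w|)) <= t * dotp aw (z - w).
  by rewrite -mulrN (ler_pM2l t0).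
have qz : t * dotp az z <= t * (`|az| * `|z|).
  by rewrite (ler_pM2l t0).
rewrite !(dotpNr, dotpZr, dotpDl, dotpZl) in c1 c2 c3.
rewrite -(ler_pM2l t0) -(ler_pM2l t0) /b.
rewrite [dotp (g x0) _]dotpBr in c2.
lra.
Qed.
End second_order.

(** * Minimality along the kernel *)

Section kernel_minimality.
Context (K : realType) (X Y : euclideanType K) (R : X -> K).
Context (Phi : {linear X -> Y}).

Definition min_along_ker (x : X) := forall w, Phi w = 0 -> R x <= R (x + w).

Lemma min_along_ker_grad x w :
  differentiable (R : X -> K^o) x -> min_along_ker x -> Phi w = 0 ->
  dotp (grad R x) w = 0.
Proof.
move=> dR minx.
suff {w}grad_ge0 w : Phi w = 0 -> 0 <= dotp (grad R x) w.
  move=> w0; apply/eqP; rewrite eq_le grad_ge0// andbT -oppr_ge0 -dotpNr.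
  by rewrite grad_ge0// linearN w0 oppr0.
move=> w0; rewrite -oppr_le0; apply: (@le0_eps_mul _ _ `|w|) => // e e0.
have [r r0 hr] := differentiable_approx dR e0.
have [t [t0 _ twr _]] := small_step w w r0.
have := hr _ twr; rewrite gradP dotpZr normrZ gtr0_norm// => /ler_normlP[_].
have := minx (t *: w); rewrite linearZ w0 /= scaler0 => /(_ erefl) mtw app.
rewrite -(ler_pM2l t0); lra.
Qed.

Lemma minimizer_min_along_ker y0 x0 :
  minimizer R Phi y0 x0 -> min_along_ker x0.
Proof. by move=> [x0y0 minx0] w w0; apply: minx0; rewrite linearD w0 addr0. Qed.

Lemma regularized_solution_min_along_ker y mu x : 0 < mu ->
  regularized_solution R Phi y mu x -> min_along_ker x.
Proof.
move=> mu0 solx w w0; have := solx (x + w).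
by rewrite /regularized linearD w0 addr0 lerD2l ler_pM2l.
Qed.

(** A vector [v] in the range of the adjoint vanishes on [Ker Phi], so it
    suffices that [v] is a subgradient of [R] at [x].  This half of the
    conjugacy between subdifferentials needs [R x <= dotp v x - conjugate R v],
    which follows by testing the subgradient [x] of the conjugate at
    [grad R x], where the conjugate is at most [dotp (grad R x) x - R x]. *)
Lemma subdiff_image_min_along_ker x :
  convex_function [set: X] (R : X -> K^o) ->
  differentiable (R : X -> K^o) x ->
  subdiff_image (conjugate R) (range (adjoint Phi)) x -> min_along_ker x.
Proof.
move=> R_convex dR [_ [y _ <-] [fin_v sub_v]] w w0.
set v := adjoint Phi y in fin_v sub_v.
have conj_grad : (conjugate R (grad R x) <= (dotp (grad R x) x - R x)%:E)%E.
  apply: ge_ereal_sup => _ [z _ <-]; rewrite lee_fin.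
  have := convex_differentiable_grad R_convex dR z; rewrite dotpBr; lra.
have conj_v : ((dotp v (x + w) - R (x + w))%:E <= conjugate R v)%E.
  by apply: ereal_sup_ubound; exists (x + w).
have := le_trans (sub_v (grad R x)) conj_grad.
have vw : dotp v w = 0 by rewrite dotpC -adjointP w0 linear0l.
move: conj_v; rewrite -(fineK fin_v) -EFinD !lee_fin dotpBr dotpDr vw.
rewrite (dotpC x) (dotpC x); lra.
Qed.

End kernel_minimality.

(** * The kernel condition *)

Section kernel_condition.
Context (K : realType) (X Y : euclideanType K) (R : X -> K) (x0 : X).
Context (Phi : {linear X -> Y}).
Context (R_convex : convex_function [set: X] (R : X -> K^o)).
Context (R_C2 : C2_around R x0).
Let g := grad R.
Let H := hessian R x0.

Lemma hessian_ge0 w : 0 <= dotp (H w) w.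
Proof.
have := hessian_three_point R_convex R_C2 w 0.
by rewrite sub0r dotpNr linear0r oppr_le0.
Qed.

Lemma hessian_eq0 w : dotp (H w) w <= 0 -> H w = 0.
Proof.
move=> Hw0.
have [m m0 hm] := three_point_cocoercive (hessian_three_point R_convex R_C2).
apply/normr0_eq0/eqP; rewrite -sqrf_eq0 eq_le sqr_ge0 andbT.
by rewrite -(ler_pM2l m0) mulr0 (le_trans (hm w)).
Qed.

Lemma C2_differentiable : differentiable (R : X -> K^o) x0.
Proof. by have [] := nbhs_singleton R_C2. Qed.

Lemma grad_difference_orthogonal h :
  min_along_ker R Phi x0 -> min_along_ker R Phi (x0 + h) ->
  differentiable (R : X -> K^o) (x0 + h) ->
  forall w, Phi w = 0 -> dotp (g (x0 + h) - g x0) w = 0.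
Proof.
move=> min0 minh dh w w0; rewrite dotpBl.
rewrite (min_along_ker_grad dh minh w0).
by rewrite (min_along_ker_grad C2_differentiable min0 w0) subrr.
Qed.

(** For tangent approximants [x0 + t w'] with [w'] close to [w],
    orthogonality reads [t dotp (H w') w = o(t)]. *)
Lemma tangent_cone_sub_ker_hessian :
  min_along_ker R Phi x0 ->
  Ker Phi `&`
    tangent_cone (subdiff_image (conjugate R) (range (adjoint Phi))) x0
  `<=` Ker Phi `&` Ker H.
Proof.
move=> min0 w [w0 [t_ [w_ [t0 t_0 w_w Ot]]]]; split=> //.
rewrite /Ker /=; apply: hessian_eq0.
have [N N0 hN] := linear_bounded H.
apply: (@le0_eps_mul _ _ ((`|w| + 1) * `|w| + N * `|w|)).
  by rewrite addr_ge0// mulr_ge0// ?ltW// addr_ge0.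
move=> e e0; have [r r0 hr] := C2_local R_C2 e0.
have tw0 : (fun k => t_ k *: w_ k) @ \oo --> (0 : X).
  by rewrite -(scale0r w); exact: cvgZ.
have [k [twr [we w1]]] : exists k,
    `|t_ k *: w_ k| < r /\ `|w - w_ k| < e /\ `|w - w_ k| < 1.
  apply: (@filter_ex _ \oo) => //; near=> k; split; last split.
  - by near: k; exact: (cvgr0_norm_lt _ tw0).
  - by near: k; exact: (cvgr_dist_lt _ _ w_w).
  - by near: k; exact: (cvgr_dist_lt _ _ w_w).
have [dk gk] := hr _ twr.
have mink := subdiff_image_min_along_ker R_convex dk (Ot k).
have gw0 := grad_difference_orthogonal min0 mink dk w0.
set a := g _ - g x0 - H _ in gk.
have aw : t_ k * dotp (H (w_ k)) w = - dotp a w.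
  by rewrite /a dotpBl gw0 linearZ dotpZl sub0r opprK.
have Hwk : dotp (H (w_ k)) w <= e * `|w_ k| * `|w|.
  rewrite -(ler_pM2l (t0 k)) aw.
  apply: le_trans (ler_norm _) _; rewrite normrN.
  apply: le_trans (dotp_norm_le _ _) _.
  apply: le_trans (ler_wpM2r (normr_ge0 w) gk) _.
  rewrite normrZ gtr0_norm//; lra.
have Hdiff : dotp (H (w - w_ k)) w <= e * N * `|w|.
  apply: le_trans (dotp_le_norm _ _) _; rewrite ler_wpM2r//.
  apply: le_trans (hN _) _; rewrite mulrC ler_wpM2r//; exact: ltW.
have wkn : `|w_ k| <= `|w| + 1.
  have := ler_distD w (w_ k) 0; rewrite !subr0 distrC; lra.
have : e * `|w_ k| * `|w| <= e * (`|w| + 1) * `|w|.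
  by rewrite ler_wpM2r// ler_wpM2l// ltW.
move: Hdiff; rewrite [H _]linearB dotpBl; lra.
Unshelve. all: by end_near. Qed.

(** [H + Phi^* Phi] inherits the three-point inequality from its two
    summands, and the vanishing of its form puts a vector in both kernels. *)
Lemma hessian_coercive :
  Ker Phi `&` Ker H = [set 0] ->
  exists2 m : K, 0 < m &
    forall h, m * `|h| ^+ 2 <= dotp (H h) h + `|Phi h| ^+ 2.
Proof.
move=> KK.
pose S : {linear X -> X} := H \+ (adjoint Phi \o Phi).
have SE u v : dotp (S u) v = dotp (H u) v + dotp (Phi u) (Phi v).
  rewrite /S /= dotpDl [dotp (adjoint _ _) _]dotpC -adjointP.
  by rewrite [X in _ + X]dotpC.
have [|h|m m0 hm] := @three_point_coercive _ _ S.
- move=> w z; rewrite !SE; apply: lerD.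
    exact: hessian_three_point R_convex R_C2 w z.
  have := sqr_ge0 (`|Phi z - Phi w|).
  rewrite linearB -dotpxx !(dotpBl, dotpBr) (dotpC (Phi z) (Phi w)) !dotpxx.
  have := sqr_ge0 (`|Phi z|); have := sqr_ge0 (`|Phi w|); lra.
- rewrite SE dotpxx => S0; have := hessian_ge0 h.
  have := sqr_ge0 (`|Phi h|) => Ph Hh.
  have Ph0 : Phi h = 0.
    by apply/normr0_eq0/eqP; rewrite -sqrf_eq0 eq_le Ph andbT; lra.
  have Hh0 : H h = 0 by apply: hessian_eq0; lra.
  by have : (Ker Phi `&` Ker H) h by []; rewrite KK.
- by exists m => // h; have := hm h; rewrite SE dotpxx.
Qed.

End kernel_condition.

(** * Growth of the Bregman distance *)

Section bregman.
Context (K : realType) (X Y : euclideanType K) (R : X -> K) (x0 : X).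
Context (Phi : {linear X -> Y}).
Context (R_convex : convex_function [set: X] (R : X -> K^o)).
Context (R_C2 : C2_around R x0).
Let g := grad R.
Let H := hessian R x0.

Definition bregman (h : X) : K := R (x0 + h) - R x0 - dotp (g x0) h.

Lemma bregman_ge0 h : 0 <= bregman h.
Proof.
have := convex_differentiable_grad R_convex (C2_differentiable R_C2) (x0 + h).
by rewrite -subr_ge0 [x0 + h - x0]addrC addKr.
Qed.

Lemma bregman_scale t h : 0 <= t -> t <= 1 -> bregman (t *: h) <= t * bregman h.
Proof.
move=> t0 t1; rewrite /bregman dotpZr mulrBr lerD2r lerBlDl.
exact: convex_along.
Qed.

(** The gradient inequality at the midpoint [k = h / 2], used towards [x0 + h],
    and the one at [x0], used towards the midpoint, bound the Bregman distance
    below by [dotp (g (x0 + k) - g x0) k], which is [dotp (H k) k] up to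
    [o(|h|^2)].  The inequality at [x0] alone would only show that the distance
    is nonnegative. *)
Lemma bregman_growth (m : K) : 0 < m ->
  (forall h, m * `|h| ^+ 2 <= dotp (H h) h + `|Phi h| ^+ 2) ->
  exists2 r : K, 0 < r & forall h, `|h| < r ->
    m * `|h| ^+ 2 <= 8 * bregman h + 2 * `|Phi h| ^+ 2.
Proof.
move=> m0 hm; have m2 : 0 < m / 2 by rewrite divr_gt0.
(* With k = h / 2: A is dotp (H k) k, while B and C are the products of k with
   the gradients at x0 and x0 + k. *)
have arith (A B C n P Rh Rk R0 : K) :
    m * n ^+ 2 <= A + P ^+ 2 -> C <= Rh - Rk -> B <= Rk - R0 ->
    - (m / 2 * n * n) <= C - B - A ->
    m * (2 * n) ^+ 2 <= 8 * (Rh - R0 - (B + B)) + 2 * (2 * P) ^+ 2.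
  by move=> *; lra.
have [r r0 hr] := C2_local R_C2 m2; exists r => // h hlt.
have [k hk] : exists k, h = k + k.
  exists (2^-1 *: h); rewrite -scalerDl -[LHS]scale1r; congr (_ *: _); lra.
have kk (V : normedModType K) (v : V) : `|v + v| = 2 * `|v|.
  by rewrite -mulr2n -scaler_nat normrZ ger0_norm.
rewrite {h}hk in hlt *.
have [|dk gk] := hr k.
  by apply: le_lt_trans hlt; rewrite kk ler_peMl// ler1n.
have up : dotp (g (x0 + k)) k <= R (x0 + (k + k)) - R (x0 + k).
  have := convex_differentiable_grad R_convex dk (x0 + (k + k)).
  by rewrite opprD addrACA subrr add0r addrK.
have dn : dotp (g x0) k <= R (x0 + k) - R x0.
  have := convex_differentiable_grad R_convex (C2_differentiable R_C2) (x0 + k).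
  by rewrite [x0 + k - x0]addrC addKr.
have low : - (m / 2 * `|k| * `|k|) <=
    dotp (g (x0 + k)) k - dotp (g x0) k - dotp (H k) k.
  rewrite -!dotpBl; have := dotp_norm_le (g (x0 + k) - g x0 - H k) k.
  rewrite ler_norml => /andP[+ _]; apply: le_trans.
  by rewrite lerN2 ler_wpM2r.
rewrite /bregman dotpDr [Phi _]linearD !kk.
exact: arith (hm k) up dn low.
Qed.

(** By convexity, if [h] were long then the vector of length [rho] in its
    direction would also have a small Bregman distance and a small image under
    [Phi], against the growth inequality. *)
Lemma bregman_localization (m r rho a b d : K) h :
  (forall h, `|h| < r -> m * `|h| ^+ 2 <= 8 * bregman h + 2 * `|Phi h| ^+ 2) ->
  0 < rho -> rho < r -> 0 <= d -> d <= 1 ->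
  d * (8 * b + 2 * a ^+ 2) < m * rho ^+ 2 ->
  `|Phi h| <= a * d -> bregman h <= b * d -> `|h| < rho.
Proof.
move=> growth rho0 rhor d0 d1 small hPhi hD.
rewrite ltNge; apply/negP => rhoh.
have h0 : 0 < `|h| by apply: lt_le_trans rhoh.
pose t := rho / `|h|; have t0 : 0 < t by rewrite divr_gt0.
have t1 : t <= 1 by rewrite ler_pdivrMr// mul1r.
have th : `|t *: h| = rho by rewrite normrZ gtr0_norm// divfK// gt_eqF.
have DtD : bregman (t *: h) <= b * d.
  apply: le_trans (bregman_scale _ (ltW t0) t1) _.
  by apply: le_trans hD; rewrite ler_piMl// bregman_ge0.
have PtP : `|Phi (t *: h)| <= a * d.
  rewrite linearZ normrZ gtr0_norm//; apply: le_trans hPhi.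
  by rewrite ler_piMl.
have PtP2 : `|Phi (t *: h)| ^+ 2 <= a ^+ 2 * d.
  apply: le_trans (_ : (a * d) ^+ 2 <= _).
    by rewrite ler_pXn2r ?nnegrE//; apply: le_trans PtP.
  by rewrite exprMn ler_wpM2l ?sqr_ge0// expr2 ler_piMl.
have := growth (t *: h); rewrite th => /(_ rhor).
move: small DtD PtP2; clear; move: (bregman _) (`|Phi _|) => *; lra.
Qed.

(** At a point where [R] is minimal along [Ker Phi] the gradient difference
    [v = g (x0 + h) - g x0] is orthogonal to [Ker Phi] and of size [O(|h|)], so
    [dotp v h] is at most a multiple of [|h| |Phi h|].  It is also close to
    [dotp (H h) h], which coercivity bounds below by [m |h|^2 - |Phi h|^2].
    Dividing by [|h|] gives a bound that is linear in [|Phi h|]. *)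
Lemma min_along_ker_error_bound (m : K) : 0 < m ->
  (forall h, m * `|h| ^+ 2 <= dotp (H h) h + `|Phi h| ^+ 2) ->
  min_along_ker R Phi x0 ->
  exists2 C : K, 0 < C & forall h,
    differentiable (R : X -> K^o) (x0 + h) ->
    `|g (x0 + h) - g x0 - H h| <= m / 2 * `|h| ->
    min_along_ker R Phi (x0 + h) -> `|h| <= C * `|Phi h|.
Proof.
move=> m0 coercive min0.
have [M M0 hM] := ker_orthogonal_bound Phi.
have [N N0 hN] := linear_bounded H.
have [P P0 hP] := linear_bounded Phi.
have m2 : 0 < m / 2 by rewrite divr_gt0.
pose L := M * (N + m / 2) + P.
have L0 : 0 < L by rewrite addr_gt0// mulr_gt0// addr_gt0.
exists (2 * L / m); first by rewrite divr_gt0// mulr_gt0.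
move=> h dh gh minh.
have := hM _ (grad_difference_orthogonal R_C2 min0 minh dh) h.
rewrite ler_norml -/g => /andP[_ up].
set v := g (x0 + h) - g x0 in gh up.
have vh : `|v| <= (N + m / 2) * `|h|.
  have -> : v = H h + (v - H h) by rewrite addrC subrK.
  by rewrite mulrDl; apply: le_trans (ler_normD _ _) _; rewrite lerD.
have low : dotp (H h) h - m / 2 * `|h| * `|h| <= dotp v h.
  have := dotp_norm_le (v - H h) h; rewrite ler_norml dotpBl => /andP[+ _].
  have := ler_wpM2r (normr_ge0 h) gh.
  move: (dotp _ _) (dotp _ _) `|v - H h| `|h| => *; lra.
have vP : M * `|v| * `|Phi h| <= M * ((N + m / 2) * `|h|) * `|Phi h|.
  by rewrite ler_wpM2r// ler_pM2l.
have PP : `|Phi h| ^+ 2 <= P * `|h| * `|Phi h|.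
  by rewrite expr2 ler_wpM2r.
have [->|hn0] := eqVneq h 0.
  by rewrite normr0 mulr_ge0// ltW// divr_gt0// mulr_gt0.
have h0 : 0 < `|h| by rewrite normr_gt0.
rewrite mulrAC ler_pdivlMr// mulrC -(ler_pM2r h0).
move: (coercive h) (le_trans low up) vP PP; rewrite /L; clear.
move: (dotp _ _) `|v| `|h| `|Phi h| => *; lra.
Qed.

End bregman.

(** * Strong minimality and stable recovery *)

(** Completing the square, the hypothesis is
    [(q - u d)^2 <= (1 + u)^2 d^2]. *)
Lemma quadratic_residual_bound (K : realType) (u d q : K) :
  0 <= u -> 0 <= d -> 0 <= q ->
  q ^+ 2 <= d ^+ 2 + 2 * (u * d * (q + d)) -> q <= (1 + 2 * u) * d.
Proof.
move=> u0 d0 q0 quad; rewrite leNgt; apply/negP => qlt.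
have ud0 : 0 <= u * d by rewrite mulr_ge0.
have : (1 + 2 * u) * d * d < q * (q - 2 * u * d).
  apply: le_lt_trans (_ : q * d < _).
    by rewrite ler_wpM2r// ltW.
  by rewrite ltr_pM2l; lra.
lra.
Qed.

Section recovery.
Context (K : realType) (X Y : euclideanType K) (R : X -> K) (x0 : X).
Context (Phi : {linear X -> Y}) (y0 : Y).
Context (R_convex : convex_function [set: X] (R : X -> K^o)).
Context (R_C2 : C2_around R x0).
Context (x0_min : minimizer R Phi y0 x0).
Let g := grad R.
Let H := hessian R x0.
Let min0 := minimizer_min_along_ker x0_min.

(** Convexity bounds [R (x0 + t w) - R x0] above by
    [t dotp (g (x0 + t w)) w], and for a common kernel vector [w] this is
    [o(t^2)]. *)
Lemma strong_minimizer_ker_trivial :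
  strong_minimizer R Phi y0 x0 -> Ker Phi `&` Ker H = [set 0].
Proof.
move=> [x0y0 [kappa [eps [kappa0 eps0 strong]]]].
apply/seteqP; split=> [w [/= w0 Hw0]|_ ->]; last by split; exact: linear0.
suff : kappa / 2 * `|w| ^+ 2 <= 0.
  rewrite pmulr_rle0 ?divr_gt0// => w2.
  by apply/normr0_eq0/eqP; rewrite -sqrf_eq0 eq_le w2 sqr_ge0.
apply: (@le0_eps_mul _ _ (`|w| ^+ 2)); first exact: sqr_ge0.
move=> e e0; have [r r0 hr] := C2_local R_C2 e0.
have re0 : 0 < Num.min r eps by rewrite lt_min r0.
have [t [t0 _ + _]] := small_step w w re0; rewrite lt_min => /andP[twr tweps].
have [dt gt] := hr _ twr.
have tw0 : Phi (t *: w) = 0 by rewrite linearZ w0 /= scaler0.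
have low : kappa / 2 * `|t *: w| ^+ 2 <= R (x0 + t *: w) - R x0.
  have := strong (x0 + t *: w); rewrite [x0 + _ - x0]addrC addKr.
  rewrite /restricted [Phi (_ + _)]linearD tw0 addr0 x0y0 eqxx -EFinB lee_fin.
  by apply; exact: ltW.
have up : R (x0 + t *: w) - R x0 <= dotp (g (x0 + t *: w)) (t *: w).
  have := convex_differentiable_grad R_convex dt x0.
  rewrite opprD addrA subrr add0r dotpNr.
  by rewrite -lerN2 opprK opprB.
have grad_small : dotp (g (x0 + t *: w)) (t *: w) <= e * `|t *: w| ^+ 2.
  rewrite -[leLHS]subr0 -(min_along_ker_grad (C2_differentiable R_C2) min0 tw0).
  rewrite -dotpBl; apply: le_trans (dotp_le_norm _ _) _.
  rewrite expr2 mulrA ler_wpM2r//.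
  by move: gt; rewrite [hessian _ _ _]linearZ Hw0 /= scaler0 subr0.
have := le_trans (le_trans low up) grad_small.
rewrite normrZ gtr0_norm// exprMn 2![_ * (t ^+ 2 * _)]mulrCA.
by rewrite ler_pM2l// exprn_gt0.
Qed.

Lemma coercive_strong_minimizer (m : K) : 0 < m ->
  (forall h, m * `|h| ^+ 2 <= dotp (H h) h + `|Phi h| ^+ 2) ->
  strong_minimizer R Phi y0 x0.
Proof.
move=> m0 coercive; have [x0y0 _] := x0_min; split=> //.
have [r r0 growth] := bregman_growth R_convex R_C2 m0 coercive.
exists (m / 4), (r / 2); split; rewrite ?divr_gt0// => x xr.
rewrite /restricted x0y0 eqxx; case: eqP => [xy0|_]; last first.
  by rewrite -EFinN addye// leey.
rewrite -EFinB lee_fin; set h := x - x0 in xr *.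
have xE : x0 + h = x by rewrite /h addrC subrK.
have h0 : Phi h = 0 by rewrite /h linearB xy0 x0y0 subrr.
have hr : `|h| < r by apply: le_lt_trans xr _; lra.
have := growth h hr; rewrite /bregman xE h0 normr0.
rewrite (min_along_ker_grad (C2_differentiable R_C2) min0 h0).
move: `|h| (R x) (R x0) => *; lra.
Qed.

(** The energy of [x] does not exceed that of [x0], and convexity trades
    [R x - R x0] for the Bregman distance and [dotp (g x0) (x - x0)], which
    orthogonality to [Ker Phi] bounds by a multiple of [|Phi (x - x0)|]. *)
Lemma regularized_solution_energy (G c d : K) (y : Y) (h : X) :
  0 <= G -> (forall h, `|dotp (g x0) h| <= G * `|Phi h|) ->
  0 < c -> 0 < d -> `|y - y0| <= d ->
  regularized_solution R Phi y (c * d) (x0 + h) ->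
  let a := 2 + 2 * (c * G) in
  `|Phi h| <= a * d /\ bregman R x0 h <= ((2 * c)^-1 + G * a) * d.
Proof.
move=> G0 hG c0 d0 yd sol a; have [x0y0 _] := x0_min.
have cd0 : 0 < c * d by rewrite mulr_gt0.
have cG0 : 0 <= c * G by rewrite mulr_ge0// ltW.
set q := `|Phi (x0 + h) - y|.
have q0 : 0 <= q by exact: normr_ge0.
have res : `|Phi h| <= q + d.
  have -> : Phi h = Phi (x0 + h) - y + (y - y0).
    by rewrite linearD x0y0 addrA subrK addrC addKr.
  by apply: le_trans (ler_normD _ _) _; rewrite lerD2l.
have Gqd : - dotp (g x0) h <= G * (q + d).
  apply: le_trans (_ : G * `|Phi h| <= _); last by rewrite ler_wpM2l.
  by have := hG h; rewrite ler_norml => /andP[+ _]; rewrite lerNl.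
have energy : q ^+ 2 / 2 + c * d * bregman R x0 h <=
    d ^+ 2 / 2 + c * d * (G * (q + d)).
  have yd2 : `|y0 - y| ^+ 2 <= d ^+ 2.
    by rewrite distrC ler_pXn2r ?nnegrE// ltW.
  have := sol x0; rewrite /regularized x0y0 -/q.
  move: (ler_wpM2l (ltW cd0) Gqd) yd2; rewrite /bregman -/g; clear.
  move: (dotp _ _) `|y0 - y| q (R _) (R _) => *; lra.
have cdB : 0 <= c * d * bregman R x0 h.
  by rewrite mulr_ge0 ?(ltW cd0)// bregman_ge0.
have qd : q <= (1 + 2 * (c * G)) * d.
  apply: quadratic_residual_bound => //; first exact: ltW.
  move: energy cdB; clear; move: (bregman _ _ _) q => *; lra.
have hPhi : `|Phi h| <= a * d by apply: le_trans res _; rewrite /a; lra.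
split=> //; rewrite -(ler_pM2l cd0).
have -> : c * d * (((2 * c)^-1 + G * a) * d) =
    d ^+ 2 / 2 + c * d * (G * (a * d)).
  by field; rewrite gt_eqF.
have : c * d * (G * (q + d)) <= c * d * (G * (a * d)).
  by rewrite ler_pM2l// ler_wpM2l// /a; lra.
move: energy (sqr_ge0 q); clear; move: (bregman _ _ _) => *; lra.
Qed.

(** The energy estimate gives [|Phi h| = O(d)] and a Bregman distance of order
    [d]; localization then puts the solution where [R] is differentiable, and
    there the error bound converts [|Phi h| = O(d)] into [|h| = O(d)]. *)
Lemma coercive_stable_recovery (m : K) : 0 < m ->
  (forall h, m * `|h| ^+ 2 <= dotp (H h) h + `|Phi h| ^+ 2) ->
  stable_recovery R Phi y0 x0.
Proof.
move=> m0 coercive.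
have [M M0 hM] := ker_orthogonal_bound Phi.
have [r1 r10 growth] := bregman_growth R_convex R_C2 m0 coercive.
have m2 : 0 < m / 2 by rewrite divr_gt0.
have [r2 r20 local] := C2_local R_C2 m2.
have [C C0 error_bound] := min_along_ker_error_bound R_C2 m0 coercive min0.
pose rho := Num.min r1 r2 / 2.
have r0 : 0 < Num.min r1 r2 by rewrite lt_min r10.
have rho0 : 0 < rho by rewrite divr_gt0.
have : rho < Num.min r1 r2 by rewrite ltr_pdivrMr// ltr_pMr// ltr1n.
rewrite lt_min => /andP[rho1 rho2].
move=> c c0; pose G := M * `|g x0|.
have G0 : 0 <= G by rewrite mulr_ge0// ltW.
have hG : forall h, `|dotp (g x0) h| <= G * `|Phi h|.
  by apply: hM => w; exact: min_along_ker_grad (C2_differentiable R_C2) min0.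
pose a := 2 + 2 * (c * G); pose b := (2 * c)^-1 + G * a.
have a0 : 0 < a by rewrite ltr_wpDr// !mulr_ge0// ltW.
have b0 : 0 < b.
  by rewrite ltr_wpDr ?mulr_ge0// ?invr_gt0 ?mulr_gt0// ltW.
have ab0 : 0 < 8 * b + 2 * a ^+ 2 by rewrite addr_gt0// mulr_gt0// exprn_gt0.
(* Below s the estimates are incompatible with growth at distance rho. *)
pose s := m * rho ^+ 2 / (8 * b + 2 * a ^+ 2).
have s0 : 0 < s by rewrite divr_gt0// mulr_gt0// exprn_gt0.
exists (C * a), (Num.min 1 s).
split; [by rewrite mulr_gt0 | by rewrite lt_min ltr01 | ].
move=> d d0; rewrite lt_min => /andP[d1 ds] y yd x sol.
have minx := regularized_solution_min_along_ker (mulr_gt0 c0 d0) sol.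
set h := x - x0; have xE : x = x0 + h by rewrite /h addrC subrK.
rewrite xE in sol minx.
have [hPhi hB] := regularized_solution_energy G0 hG c0 d0 yd sol.
have hrho : `|h| < rho.
  apply: (bregman_localization R_convex R_C2 growth rho0 rho1 _ _ _ hPhi hB).
  - exact: ltW.
  - exact: ltW.
  - by rewrite -ltr_pdivlMr.
have [dh gh] := local h (lt_trans hrho rho2).
apply: le_trans (error_bound h dh gh minx) _.
by rewrite -mulrA ler_pM2l.
Qed.

End recovery.

Theorem corollary3p7 (K : realType) (X Y : euclideanType K)
    (Phi : {linear X -> Y}) (y0 : Y) (x0 : X) (R : X -> K)
    (R_convex : convex_function [set: X] (R : X -> K^o))
    (R_C2 : C2_around R x0)
    (x0_min : minimizer R Phi y0 x0) :
  [/\ Ker Phi `&`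
        tangent_cone (subdiff_image (conjugate R) (range (adjoint Phi))) x0
      `<=` Ker Phi `&` Ker (hessian R x0),
      Ker Phi `&` Ker (hessian R x0) = [set 0] ->
        stable_recovery R Phi y0 x0 &
      Ker Phi `&` Ker (hessian R x0) = [set 0] <->
        strong_minimizer R Phi y0 x0].
Proof.
split.
- exact/(tangent_cone_sub_ker_hessian R_convex R_C2)/
    (minimizer_min_along_ker x0_min).
- move=> /(hessian_coercive R_convex R_C2)[m m0 coercive].
  exact: (@coercive_stable_recovery _ _ _ _ _ _ _ R_convex R_C2 x0_min m m0).
- split; last exact: strong_minimizer_ker_trivial.
  move=> /(hessian_coercive R_convex R_C2)[m m0 coercive].
  exact: (@coercive_strong_minimizer _ _ _ _ _ _ _ R_convex R_C2 x0_min m m0).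
Qed.
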